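(* Let $$ w=\begin{pmatrix}1+\sqrt5\\ 1+i+j+k\end{pmatrix},\qquad w^\perp=\begin{pmatrix}-1+i+j+k\\ 1+\sqrt5\end{pmatrix}\in\mathbb{H}^2. $$ The orbit of the line $w\mathbb{H}$ under $P_1$ and its orbit under $P_2$ both equal the set of $16$ lines spanned by $$ \begin{pmatrix}1+\sqrt5\\ q(1+i+j+k)\end{pmatrix},\quad \begin{pmatrix}q(1+i+j+k)\\ 1+\sqrt5\end{pmatrix},\qquad q\in Q_8, $$ and the orbit of the line $w^\perp\mathbb{H}$ under $P_1$ and its orbit under $P_2$ both equal the set of $16$ lines spanned by $$ \begin{pmatrix}1+\sqrt5\\ q(-1+i+j+k)\end{pmatrix},\quad \begin{pmatrix}q(-1+i+j+k)\\ 1+\sqrt5\end{pmatrix},\qquad q\in Q_8. $$ Each of these two sets of $16$ lines has angle set exactly $\{\tfrac15,\tfrac35\}$, is a spherical $(3,3)$-design for $\mathbb{H}^2$, and meets the special bound for lines in $\mathbb{H}^2$ with two nonzero angles $\alpha=\tfrac15$, $\beta=\tfrac35$.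
   Context: $\mathbb{H}$ denotes the quaternions and $Q_8=\{\pm1,\pm i,\pm j,\pm k\}$ the quaternion group. $\mathbb{H}^d$ is a right $\mathbb{H}$-module, with matrices acting on the left, inner product $\langle v,w\rangle=\sum_a\overline{v_a}\,w_a$ and $\|v\|^2=\langle v,v\rangle$. A line is a subspace $v\mathbb{H}$ with $v\ne0$. The angle between two different lines spanned by unit vectors $v,w$ is $|\langle v,w\rangle|^2$, and the angle set of a set of lines is the set of angles between its different lines. The groups $P_1,P_2$ are the (finite, unitary) matrix groups $$P_1=\left\langle \begin{pmatrix}i&0\\0&1\end{pmatrix},\ \tfrac12\begin{pmatrix}1+j&-1+j\\-1+j&1+j\end{pmatrix}\right\rangle,\qquad P_2=\left\langle \begin{pmatrix}i&0\\0&1\end{pmatrix},\ \begin{pmatrix}j&0\\0&1\end{pmatrix},\ \tfrac12\begin{pmatrix}1+j&-1+j\\-1+j&1+j\end{pmatrix}\right\rangle,$$ of orders $320$ and $1920$. They act on lines by $g\cdot(v\mathbb{H})=(gv)\mathbb{H}$. A set of lines given by $n$ unit vectors $v_1,\dots,v_n\in\mathbb{H}^d$ is a spherical $(t,t)$-design for $\mathbb{H}^d$ (equivalently, a quaternionic projective spherical $t$-design) if $$\sum_{a=1}^n\sum_{b=1}^n|\langle v_a,v_b\rangle|^{2t}=c_t(\mathbb{H}^d)\Bigl(\sum_{\ell=1}^n\|v_\ell\|^{2t}\Bigr)^2,\qquad c_t(\mathbb{H}^d)=\prod_{m=0}^{t-1}\frac{2+m}{2d+m}.$$ The special bound (Hoggar)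 for the number $n$ of lines in $\mathbb{H}^d$ with two nonzero angles $\{\alpha,\beta\}$ is $$ n\le\frac{d(2d+1)(1-\alpha)(1-\beta)}{3-(2d+1)(\alpha+\beta)+d(2d+1)\alpha\beta}. $$ A set of lines meets the special bound if equality holds. *)

(* Defs.v *)
From HB Require Import structures.
From mathcomp Require Import all_boot all_order all_algebra.
From mathcomp Require Import all_classical all_reals.
From mathcomp Require Import ring.

Set Implicit Arguments.
Unset Strict Implicit.
Unset Printing Implicit Defensive.

Import Order.TTheory GRing.Theory Num.Theory.

Local Open Scope classical_set_scope.
Local Open Scope ring_scope.

(* [Quat a b c d] is a + b i + c j + d k. *)
Record quat (R : Type) := Quat { qre : R; qim_i : R; qim_j : R; qim_k : R }.

Definition prod_of_quat (R : Type) (x : quat R) : R * R * R * R :=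
  (qre x, qim_i x, qim_j x, qim_k x).

Definition quat_of_prod (R : Type) (p : R * R * R * R) : quat R :=
  let: (a, b, c, d) := p in Quat a b c d.

Lemma prod_of_quatK (R : Type) : cancel (@prod_of_quat R) (@quat_of_prod R).
Proof. by case. Qed.

HB.instance Definition _ (R : choiceType) :=
  Choice.copy (quat R) (can_type (@prod_of_quatK R)).

Definition addq (R : comNzRingType) (x y : quat R) : quat R :=
  Quat (qre x + qre y) (qim_i x + qim_i y) (qim_j x + qim_j y)
       (qim_k x + qim_k y).

Definition oppq (R : comNzRingType) (x : quat R) : quat R :=
  Quat (- qre x) (- qim_i x) (- qim_j x) (- qim_k x).

Definition mulq (R : comNzRingType) (x y : quat R) : quat R :=
  let: Quat a b c d := x in
  let: Quat a' b' c' d' := y in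
  Quat (a * a' - b * b' - c * c' - d * d')
       (a * b' + b * a' + c * d' - d * c')
       (a * c' - b * d' + c * a' + d * b')
       (a * d' + b * c' - c * b' + d * a').

Lemma addqA (R : comNzRingType) : associative (@addq R).
Proof. by move=> x y z; congr Quat; rewrite /= addrA. Qed.

Lemma addqC (R : comNzRingType) : commutative (@addq R).
Proof. by move=> x y; congr Quat; rewrite addrC. Qed.

Lemma add0q (R : comNzRingType) : left_id (Quat 0 0 0 0) (@addq R).
Proof. by case=> a b c d; congr Quat; rewrite /= add0r. Qed.

Lemma addNq (R : comNzRingType) :
  left_inverse (Quat 0 0 0 0) (@oppq R) (@addq R).
Proof. by case=> a b c d; congr Quat; rewrite /= addNr. Qed.

HB.instance Definition _ (R : comNzRingType) :=
  GRing.isZmodule.Build (quat R) (@addqA R) (@addqC R) (@add0q R) (@addNq R).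

Lemma mulqA (R : comNzRingType) : associative (@mulq R).
Proof. by move=> [a b c d] [a' b' c' d'] [a2 b2 c2 d2]; congr Quat; ring. Qed.

Lemma mul1q (R : comNzRingType) : left_id (Quat 1 0 0 0) (@mulq R).
Proof. by move=> [a b c d]; congr Quat; ring. Qed.

Lemma mulq1 (R : comNzRingType) : right_id (Quat 1 0 0 0) (@mulq R).
Proof. by move=> [a b c d]; congr Quat; ring. Qed.

Lemma mulqDl (R : comNzRingType) : left_distributive (@mulq R) (@addq R).
Proof. by move=> [a b c d] [a' b' c' d'] [a2 b2 c2 d2]; congr Quat => /=; ring. Qed.

Lemma mulqDr (R : comNzRingType) : right_distributive (@mulq R) (@addq R).
Proof. by move=> [a b c d] [a' b' c' d'] [a2 b2 c2 d2]; congr Quat => /=; ring. Qed.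

Lemma oneq_neq0 (R : comNzRingType) : Quat 1 0 0 0 != 0 :> quat R.
Proof. by apply/eqP; case=> /eqP; rewrite oner_eq0. Qed.

HB.instance Definition _ (R : comNzRingType) :=
  GRing.Zmodule_isNzRing.Build (quat R) (@mulqA R) (@mul1q R) (@mulq1 R)
    (@mulqDl R) (@mulqDr R) (@oneq_neq0 R).

Definition qreal (R : comNzRingType) (a : R) : quat R := Quat a 0 0 0.
Definition qi (R : comNzRingType) : quat R := Quat 0 1 0 0.
Definition qj (R : comNzRingType) : quat R := Quat 0 0 1 0.
Definition qk (R : comNzRingType) : quat R := Quat 0 0 0 1.
Arguments qi {R}.
Arguments qj {R}.
Arguments qk {R}.

Lemma quat_relations (R : comNzRingType) :
  [/\ qi * qi = -1 :> quat R, qj * qj = -1 :> quat R, qk * qk = -1 :> quat R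
    & qi * qj * qk = -1 :> quat R].
Proof. by split; congr Quat => /=; ring. Qed.

Definition Q8 (R : comNzRingType) : set (quat R) :=
  [set 1; -1; qi; - qi; qj; - qj; qk; - qk].
Arguments Q8 R : clear implicits.

Definition qconj (R : comNzRingType) (x : quat R) : quat R :=
  Quat (qre x) (- qim_i x) (- qim_j x) (- qim_k x).

Definition qabs (R : rcfType) (x : quat R) : R :=
  Num.sqrt (qre x ^+ 2 + qim_i x ^+ 2 + qim_j x ^+ 2 + qim_k x ^+ 2).

Definition qdot (R : comNzRingType) (d : nat) (v w : 'cV[quat R]_d) : quat R :=
  \sum_(a < d) qconj (v a 0) * w a 0.

Definition qnorm (R : rcfType) (d : nat) (v : 'cV[quat R]_d) : R :=
  Num.sqrt (qre (qdot v v)).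

(* Taking the real part in [qnorm] loses nothing: <v,v> is real and >= 0. *)
Lemma qdot_qnorm (R : rcfType) (d : nat) (v : 'cV[quat R]_d) :
  qdot v v = qreal (qnorm v ^+ 2).
Proof.
have qrealD (a b : R) : qreal (a + b) = qreal a + qreal b.
  by congr Quat; rewrite /= addr0.
have [r r_ge0 vE] : exists2 r : R, 0 <= r & qdot v v = qreal r.
  rewrite /qdot; elim/big_ind: _ => [|x y [r r0 ->] [s s0 ->]|a _].
  - by exists 0.
  - by exists (r + s); rewrite ?addr_ge0 ?qrealD.
  case: (v a 0) => x y z t.
  exists (x ^+ 2 + y ^+ 2 + z ^+ 2 + t ^+ 2); first by rewrite !addr_ge0 ?sqr_ge0.
  by congr Quat => /=; ring.
by rewrite /qnorm vE sqr_sqrtr.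
Qed.

(* The right multiple v q, as the product of a column with a 1 x 1 matrix. *)
Definition rscale (R : comNzRingType) (d : nat) (v : 'cV[quat R]_d)
  (q : quat R) : 'cV[quat R]_d := v *m q%:M.

(* The subspace v H; it is a line when v != 0. *)
Definition line (R : comNzRingType) (d : nat) (v : 'cV[quat R]_d) :
  set 'cV[quat R]_d := [set rscale v q | q in [set: quat R]].

Definition line_act (R : comNzRingType) (d : nat) (g : 'M[quat R]_d)
  (L : set 'cV[quat R]_d) : set 'cV[quat R]_d := [set g *m x | x in L].

Lemma line_act_line (R : comNzRingType) (d : nat) (g : 'M[quat R]_d)
  (v : 'cV[quat R]_d) : line_act g (line v) = line (g *m v).
Proof.
rewrite /line_act /line image_comp; apply: eq_imagel => q _ /=.
by rewrite /rscale mulmxA.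
Qed.

Definition line_orbit (R : comNzRingType) (d : nat) (G : set 'M[quat R]_d)
  (L : set 'cV[quat R]_d) : set (set 'cV[quat R]_d) := [set line_act g L | g in G].

Definition matrix_group (R : comNzRingType) (d : nat)
  (G : set 'M[quat R]_d) : Prop :=
  [/\ G 1%:M,
      forall g h, G g -> G h -> G (g *m h)
    & forall g, G g -> exists h, [/\ G h, g *m h = 1%:M & h *m g = 1%:M]].

(* The group generated by a set of invertible matrices. *)
Definition generated_group (R : comNzRingType) (d : nat) (S : set 'M[quat R]_d) :
  set 'M[quat R]_d := smallest (@matrix_group R d) S.

Definition col2 (R : comNzRingType) (a b : quat R) : 'cV[quat R]_2 :=
  \col_(i < 2) if i == ord0 then a else b.

Definition mx2 (R : comNzRingType) (a b c d : quat R) : 'M[quat R]_2 :=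
  \matrix_(i < 2, j < 2)
    if i == ord0 then (if j == ord0 then a else b)
    else (if j == ord0 then c else d).

Definition P1 (R : rcfType) : set 'M[quat R]_2 :=
  generated_group [set mx2 qi 0 0 1;
                       qreal 2^-1 *: mx2 (1 + qj) (-1 + qj) (-1 + qj) (1 + qj)].

Definition P2 (R : rcfType) : set 'M[quat R]_2 :=
  generated_group [set mx2 qi 0 0 1;
                       mx2 qj 0 0 1;
                       qreal 2^-1 *: mx2 (1 + qj) (-1 + qj) (-1 + qj) (1 + qj)].

Arguments P1 R : clear implicits.
Arguments P2 R : clear implicits.

Definition angle_set (R : rcfType) (d : nat) (X : set (set 'cV[quat R]_d)) :
  set R :=
  [set r | exists v w : 'cV[quat R]_d,
     [/\ qnorm v = 1 /\ qnorm w = 1, X (line v), X (line w), line v <> line w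
       & r = qabs (qdot v w) ^+ 2]].

(* X consists of the n different lines spanned by the unit vectors v_a. *)
Definition lines_given_by (R : rcfType) (d n : nat) (v : 'I_n -> 'cV[quat R]_d)
  (X : set (set 'cV[quat R]_d)) : Prop :=
  [/\ forall a, qnorm (v a) = 1,
      injective (fun a => line (v a))
    & X = range (fun a => line (v a))].

Definition design_const (R : rcfType) (t d : nat) : R :=
  \prod_(0 <= m < t) ((2 + m)%:R / (2 * d + m)%:R).

Definition spherical_design (R : rcfType) (t d : nat)
  (X : set (set 'cV[quat R]_d)) : Prop :=
  exists n (v : 'I_n -> 'cV[quat R]_d),
    lines_given_by v X /\
    \sum_(a < n) \sum_(b < n) qabs (qdot (v a) (v b)) ^+ (2 * t) =
      design_const R t d * (\sum_(l < n) qnorm (v l) ^+ (2 * t)) ^+ 2.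

Definition special_bound (R : rcfType) (d : nat) (alpha beta : R) : R :=
  (d * (2 * d + 1))%:R * (1 - alpha) * (1 - beta) /
  (3 - (2 * d + 1)%:R * (alpha + beta) + (d * (2 * d + 1))%:R * alpha * beta).

(* The two angles make X nonempty, so the equality fails when the denominator
   of the bound vanishes (its value is then 0). *)
Definition meets_special_bound (R : rcfType) (d : nat)
  (X : set (set 'cV[quat R]_d)) (alpha beta : R) : Prop :=
  [/\ [/\ alpha != 0, beta != 0 & alpha != beta],
      angle_set X = [set alpha; beta]
    & exists n, (X #= `I_n)%card /\ n%:R = special_bound d alpha beta].

(* The lines spanned by (1 + sqrt 5, q u) and (q u, 1 + sqrt 5), q in Q8. *)
Definition Q8_lines (R : rcfType) (u : quat R) : set (set 'cV[quat R]_2) :=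
  [set line (col2 (qreal (1 + Num.sqrt 5)) (q * u)) | q in Q8 R] `|`
  [set line (col2 (q * u) (qreal (1 + Num.sqrt 5))) | q in Q8 R].

(* Main.v *)
Require Import Defs.
From mathcomp Require Import all_boot all_order all_algebra.
From mathcomp Require Import all_classical all_reals.
From mathcomp Require Import ring lra.

Set Implicit Arguments.
Unset Strict Implicit.
Unset Printing Implicit Defensive.

Import Order.TTheory GRing.Theory Num.Theory.

Local Open Scope classical_set_scope.
Local Open Scope ring_scope.

(** The Bloch (or Hopf) map sends the line v H to the traceless part of the
    projection onto it: a Hermitian matrix with rows (x, y) and (conj y, - x),
    that is, a point (x, y) of a sphere in R + H = R^5.  For radius sqrt 5 the
    sixteen given lines become sixteen points with coordinates +1 and -1 and
    fixed product of the five signs: the vertices of a 5-dimensional demicube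
    ([Q8_linesE]).  The lines of w and of its orthogonal companion give the two
    opposite demicubes, told apart by a Boolean p.

    Everything is then read off from the demicube.  The angle of two lines is
    (5 + <e, e'>) / 10 for the corresponding vertices ([angle_bloch],
    [demi_line_angle]), and the inner products of different vertices are 1 and
    -3, whence the angles 3/5 and 1/5.  The sixteen vertices form a torsor under
    the even sign changes, so the double sum in the design condition is 16 times
    the row sum computed in [sum_sign_angle3]; the special bound is an evaluation
    at these angles.

    For the orbits, a line is the eigenspace of its Bloch matrix for sqrt 5, and
    a matrix moves eigenspaces by conjugation ([line_act_bloch]).  Each generator
    acts as a signed permutation of the five coordinates preserving the demicube
    ([line_act_i], [line_act_j], [line_act_refl]), so orbits stay inside it; the
    two generators of the smaller group already reach all its vertices
    ([sign_transitive]). *)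

(** * Quaternions and lines *)

Lemma qrealD (R : comNzRingType) (a b : R) : qreal (a + b) = qreal a + qreal b.
Proof. by congr Quat => /=; rewrite addr0. Qed.

Lemma qrealM (R : comNzRingType) (a b : R) : qreal (a * b) = qreal a * qreal b.
Proof. by congr Quat => /=; ring. Qed.

Lemma qrealC (R : comNzRingType) (a : R) (x : quat R) : qreal a * x = x * qreal a.
Proof. by case: x => x y z t; congr Quat => /=; ring. Qed.

Lemma qconjM (R : comNzRingType) (x y : quat R) : qconj (x * y) = qconj y * qconj x.
Proof. by case: x y => [x y z t] [x' y' z' t']; congr Quat => /=; ring. Qed.

Lemma qconjK (R : comNzRingType) : involutive (@qconj R).
Proof. by case=> x y z t; congr Quat => /=; rewrite opprK. Qed.

Definition qnormsq (R : comNzRingType) (x : quat R) : R :=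
  qre x ^+ 2 + qim_i x ^+ 2 + qim_j x ^+ 2 + qim_k x ^+ 2.

Lemma qabs_sqr (R : rcfType) (x : quat R) : qabs x ^+ 2 = qnormsq x.
Proof. by rewrite sqr_sqrtr // !addr_ge0 // sqr_ge0. Qed.

Lemma qnormsqM (R : comNzRingType) (x y : quat R) :
  qnormsq (x * y) = qnormsq x * qnormsq y.
Proof.
by case: x y => [x y z t] [x' y' z' t']; rewrite /qnormsq /=; ring.
Qed.

Lemma qnormsq_conj (R : comNzRingType) (x : quat R) : qnormsq (qconj x) = qnormsq x.
Proof. by rewrite /qnormsq /= !sqrrN. Qed.

Lemma qnormsq_real (R : comNzRingType) (a : R) : qnormsq (qreal a) = a ^+ 2.
Proof. by rewrite /qnormsq /= expr0n /= !addr0. Qed.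

Lemma mulq_conj (R : comNzRingType) (x : quat R) : x * qconj x = qreal (qnormsq x).
Proof. by case: x => x y z t; congr Quat => /=; rewrite /qnormsq /=; ring. Qed.

Lemma mulq_conjl (R : comNzRingType) (x : quat R) : qconj x * x = qreal (qnormsq x).
Proof. by rewrite -{2}(qconjK x) mulq_conj qnormsq_conj. Qed.

Lemma rscale_coef (R : comNzRingType) (d : nat) (v : 'cV[quat R]_d) q a :
  rscale v q a 0 = v a 0 * q.
Proof. by rewrite !mxE big_ord1 !mxE /= mulr1n. Qed.

Lemma rscaleA (R : comNzRingType) (d : nat) (v : 'cV[quat R]_d) p q :
  rscale (rscale v p) q = rscale v (p * q).
Proof. by apply/colP => a; rewrite !rscale_coef mulrA. Qed.

Lemma rscale1 (R : comNzRingType) (d : nat) (v : 'cV[quat R]_d) : rscale v 1 = v.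
Proof. by apply/colP => a; rewrite !rscale_coef mulr1. Qed.

Lemma line_self (R : comNzRingType) (d : nat) (v : 'cV[quat R]_d) : line v v.
Proof. by exists 1 => //; exact: rscale1. Qed.

Lemma line_rscale (R : comNzRingType) (d : nat) (v : 'cV[quat R]_d) p q :
  p * q = 1 -> line (rscale v p) = line v.
Proof.
move=> pq; apply/seteqP; split=> _ [s _ <-].
  by exists (p * s) => //; rewrite rscaleA.
by exists (q * s) => //; rewrite rscaleA mulrA pq mul1r.
Qed.

Lemma qdot_rscale (R : comNzRingType) (d : nat) (v w : 'cV[quat R]_d) p q :
  qdot (rscale v p) (rscale w q) = qconj p * qdot v w * q.
Proof.
rewrite /qdot mulr_sumr mulr_suml; apply: eq_bigr => a _.
by rewrite !rscale_coef qconjM !mulrA.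
Qed.

Lemma qnorm_ge0 (R : rcfType) (d : nat) (v : 'cV[quat R]_d) : 0 <= qnorm v.
Proof. exact: sqrtr_ge0. Qed.

Lemma qreal_inj (R : comNzRingType) : injective (@qreal R).
Proof. by move=> a b []. Qed.

Lemma qnorm_sqr_rscale (R : rcfType) (d : nat) (v : 'cV[quat R]_d) q :
  qnorm (rscale v q) ^+ 2 = qnorm v ^+ 2 * qnormsq q.
Proof.
apply: (@qreal_inj R); rewrite -qdot_qnorm qdot_rscale qdot_qnorm.
by rewrite -qrealC -mulrA mulq_conjl -qrealM.
Qed.

(** A unit vector of a line is determined up to a unit quaternion on the right,
    which changes <v, w> only by unit factors on either side.  Hence the angle
    of two lines can be computed from any spanning vectors. *)
Lemma angle_rescale (R : rcfType) (d : nat) (v w v' w' : 'cV[quat R]_d) :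
  line v v' -> line w w' -> qnorm v' = 1 -> qnorm w' = 1 ->
  qabs (qdot v' w') ^+ 2 = qnormsq (qdot v w) / (qnorm v ^+ 2 * qnorm w ^+ 2).
Proof.
move=> [p _ <-] [q _ <-] np nq.
have {np} Np : qnorm v ^+ 2 * qnormsq p = 1.
  by rewrite -qnorm_sqr_rscale np expr1n.
have {nq} Nq : qnorm w ^+ 2 * qnormsq q = 1.
  by rewrite -qnorm_sqr_rscale nq expr1n.
have [v0 w0] : qnorm v != 0 /\ qnorm w != 0.
  split; apply/eqP => e; [move: Np | move: Nq];
    by rewrite e expr0n mul0r => /esym/eqP; rewrite oner_eq0.
rewrite qabs_sqr qdot_rscale !qnormsqM qnormsq_conj.
have -> : qnormsq p = (qnorm v ^+ 2)^-1.
  by apply: (mulfI (expf_neq0 2 v0)); rewrite Np divff ?expf_neq0.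
have -> : qnormsq q = (qnorm w ^+ 2)^-1.
  by apply: (mulfI (expf_neq0 2 w0)); rewrite Nq divff ?expf_neq0.
by rewrite (invfM (qnorm v ^+ 2)) -mulrA mulrCA.
Qed.

Definition normalize (R : rcfType) (d : nat) (v : 'cV[quat R]_d) : 'cV[quat R]_d :=
  rscale v (qreal (qnorm v)^-1).

Lemma qnorm_normalize (R : rcfType) (d : nat) (v : 'cV[quat R]_d) :
  qnorm v != 0 -> qnorm (normalize v) = 1.
Proof.
move=> v0; apply: (@pexpIrn R 2); rewrite ?nnegrE ?qnorm_ge0 ?ler01 //.
by rewrite qnorm_sqr_rscale qnormsq_real -exprMn divff // expr1n.
Qed.

Lemma line_normalize (R : rcfType) (d : nat) (v : 'cV[quat R]_d) :
  qnorm v != 0 -> line (normalize v) = line v.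
Proof.
by move=> v0; apply: (@line_rscale _ _ _ _ (qreal (qnorm v))); rewrite -qrealM mulVf.
Qed.

(** * Orbits under generated groups *)

Definition permutes_lines (R : comNzRingType) (d : nat)
    (X : set (set 'cV[quat R]_d)) : set 'M[quat R]_d :=
  [set g | (exists h, g *m h = 1%:M /\ h *m g = 1%:M) /\ line_act g @` X = X].

Lemma line_act1 (R : comNzRingType) (d : nat) (L : set 'cV[quat R]_d) :
  line_act 1%:M L = L.
Proof.
by apply/seteqP; split=> [_ [v Lv <-]|v Lv]; [|exists v]; rewrite ?mul1mx.
Qed.

Lemma line_actM (R : comNzRingType) (d : nat) (g h : 'M[quat R]_d)
    (L : set 'cV[quat R]_d) :
  line_act (g *m h) L = line_act g (line_act h L).
Proof.
by rewrite /line_act image_comp; apply: eq_imagel => v _ /=; rewrite mulmxA.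
Qed.

(** Containing a generating set is enough for containing the generated group,
    so this turns invariance of X under the generators into invariance under
    the group.  Equality of sets, instead of inclusion, in [permutes_lines] is
    what makes inverses available without a finiteness argument. *)
Lemma permutes_lines_group (R : comNzRingType) (d : nat)
  (X : set (set 'cV[quat R]_d)) : matrix_group (permutes_lines X).
Proof.
split=> [|g h [[g' [gg' g'g]] gX] [[h' [hh' h'h]] hX]|g [[h [gh hg]] gX]].
- split; first by exists 1%:M; rewrite mulmx1.
  by rewrite (eq_imagel (fun L _ => line_act1 L)) image_id.
- split.
    exists (h' *m g'); split.
      by rewrite mulmxA -(mulmxA g) hh' mulmx1.
    by rewrite mulmxA -(mulmxA h') g'g mulmx1.
  by rewrite (eq_imagel (fun L _ => line_actM g h L)) -[RHS]gX -[in RHS]hX image_comp.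
exists h; split=> //; split; first by exists g.
rewrite -[in LHS]gX image_comp.
rewrite (eq_imagel (f' := id)) ?image_id // => L _ /=.
by rewrite -line_actM hg line_act1.
Qed.

Lemma orbit_generated_sub (R : comNzRingType) (d : nat) (S : set 'M[quat R]_d)
    (X : set (set 'cV[quat R]_d)) (L : set 'cV[quat R]_d) :
  S `<=` permutes_lines X -> X L -> line_orbit (generated_group S) L `<=` X.
Proof.
move=> SX XL _ [g Sg <-].
have [_ <-] : permutes_lines X g.
  exact: (smallest_sub (permutes_lines_group X) SX) Sg.
by exists L.
Qed.

Lemma orbit_generated1 (R : comNzRingType) (d : nat) (S : set 'M[quat R]_d)
    (L : set 'cV[quat R]_d) : line_orbit (generated_group S) L L.
Proof. by exists 1%:M; [move=> G [[]]|exact: line_act1]. Qed.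

Lemma orbit_generated_act (R : comNzRingType) (d : nat) (S : set 'M[quat R]_d)
    (L M : set 'cV[quat R]_d) (g : 'M[quat R]_d) :
  S g -> line_orbit (generated_group S) L M ->
  line_orbit (generated_group S) L (line_act g M).
Proof.
move=> Sg [h Sh <-]; exists (g *m h); last exact: line_actM.
by move=> G GS; case: (GS) => -[_ GM _] SG; apply: GM; [exact: SG|exact: Sh].
Qed.

(** * Coordinates in dimension two *)

Lemma mx2_col2 (R : comNzRingType) (a b c d x y : quat R) :
  mx2 a b c d *m col2 x y = col2 (a * x + b * y) (c * x + d * y).
Proof.
apply/colP => i; rewrite !mxE !big_ord_recl big_ord0 !mxE addr0 /=.
by case: ifP => _.
Qed.

Lemma mulmx2 (R : comNzRingType) (a b c d a' b' c' d' : quat R) :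
  mx2 a b c d *m mx2 a' b' c' d' =
  mx2 (a * a' + b * c') (a * b' + b * d') (c * a' + d * c') (c * b' + d * d').
Proof.
apply/matrixP => i j; rewrite !mxE !big_ord_recl big_ord0 !mxE addr0 /=.
by do 2!case: ifP => _.
Qed.

Lemma mx2_1 (R : comNzRingType) : mx2 1 0 0 1 = 1%:M :> 'M[quat R]_2.
Proof. by apply/matrixP => -[[|[|//]] ?] [[|[|//]] ?]; rewrite !mxE. Qed.

Lemma scale_mx2 (R : comNzRingType) (e a b c d : quat R) :
  e *: mx2 a b c d = mx2 (e * a) (e * b) (e * c) (e * d).
Proof. by apply/matrixP => i j; rewrite !mxE; do 2!case: ifP => _. Qed.

Lemma rscale_col2 (R : comNzRingType) (x y q : quat R) :
  rscale (col2 x y) q = col2 (x * q) (y * q).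
Proof. by apply/colP => i; rewrite rscale_coef !mxE; case: ifP. Qed.

Lemma col2P (R : comNzRingType) (v : 'cV[quat R]_2) : exists x y, v = col2 x y.
Proof.
exists (v 0 0), (v 1 0); apply/colP => -[[|[|//]] i]; rewrite mxE /=;
  by congr (v _ _); apply/val_inj.
Qed.

Lemma col2_inj (R : comNzRingType) (x y x' y' : quat R) :
  col2 x y = col2 x' y' -> x = x' /\ y = y'.
Proof. by move=> /colP e; split; [move: (e 0) | move: (e 1)]; rewrite !mxE. Qed.

Lemma qdot_col2 (R : comNzRingType) (x y x' y' : quat R) :
  qdot (col2 x y) (col2 x' y') = qconj x * x' + qconj y * y'.
Proof. by rewrite /qdot !big_ord_recl big_ord0 addr0 !mxE. Qed.

Lemma qnorm_col2 (R : rcfType) (x y : quat R) :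
  qnorm (col2 x y) ^+ 2 = qnormsq x + qnormsq y.
Proof.
apply: (@qreal_inj R); rewrite -qdot_qnorm qdot_col2 !mulq_conjl.
by congr Quat => /=; rewrite addr0.
Qed.

(** * Bloch coordinates of quaternionic lines *)

(** The traceless Hermitian matrices with real x and quaternion y form a
    five-dimensional Euclidean space, and [bloch_mx x y] squares to the scalar
    x^2 + |y|^2. *)
Definition bloch_mx (R : comNzRingType) (x : R) (y : quat R) : 'M[quat R]_2 :=
  mx2 (qreal x) y (qconj y) (- qreal x).

(** On the sphere of radius r > 0 the matrix [bloch_mx x y] has eigenvalues r
    and - r, and the eigenspace for r is a line; the points of the 4-sphere
    parametrize the quaternionic projective line this way.  As sets of vectors
    these eigenspaces are independent of a choice of spanning vector. *)
Definition bloch_line (R : comNzRingType) (r x : R) (y : quat R) : set 'cV[quat R]_2 :=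
  [set v | bloch_mx x y *m v = rscale v (qreal r)].

(** Matrices move eigenspaces by conjugating the operator.  So a group that
    conjugates Bloch matrices by signed coordinate permutations acts on the
    lines by those permutations, and no quaternionic scalar relating two
    spanning vectors has to be found. *)
Lemma line_act_bloch (R : comNzRingType) (g h : 'M[quat R]_2) (r x x' : R) (y y' : quat R) :
  g *m h = 1%:M -> h *m g = 1%:M ->
  g *m bloch_mx x y = bloch_mx x' y' *m g ->
  line_act g (bloch_line r x y) = bloch_line r x' y'.
Proof.
move=> gh hg gM; apply/seteqP; split=> [_ [v Mv <-]|w Mw].
  by rewrite /bloch_line /= mulmxA -gM -mulmxA Mv /rscale mulmxA.
exists (h *m w); last by rewrite mulmxA gh mul1mx.
have Mh : bloch_mx x y *m h = h *m bloch_mx x' y'.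
  by rewrite -[LHS]mul1mx -hg -mulmxA (mulmxA g) gM -(mulmxA (bloch_mx _ _)) gh mulmx1.
by rewrite /bloch_line /= mulmxA Mh -mulmxA Mw /rscale mulmxA.
Qed.

(** The spanning vector is the first column of [bloch_mx x y + r], which is
    sent into the eigenspace because the Bloch matrix squares to r^2. *)
Lemma bloch_lineE (R : fieldType) (r x : R) (y : quat R) :
  x ^+ 2 + qnormsq y = r ^+ 2 -> r + x != 0 ->
  bloch_line r x y = line (col2 (qreal (r + x)) (qconj y)).
Proof.
move=> xy rx0; apply/seteqP; split=> [v|_ [q _ <-]]; last first.
  rewrite /bloch_line /= /rscale mulmxA mx2_col2 mulq_conj.
  have -> : qnormsq y = r ^+ 2 - x ^+ 2 by rewrite -xy addrC addKr.
  have -> : col2 (qreal x * qreal (r + x) + qreal (r ^+ 2 - x ^+ 2))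
                 (qconj y * qreal (r + x) + - qreal x * qconj y) =
            rscale (col2 (qreal (r + x)) (qconj y)) (qreal r).
    rewrite rscale_col2; case: y {xy} => a b c d.
    by congr col2; congr Quat => /=; ring.
  by rewrite [LHS]rscaleA [RHS]rscaleA qrealC.
have [a [b ->]] := col2P v; rewrite /bloch_line /= mx2_col2 rscale_col2.
case/col2_inj=> _ eb; exists (qreal (r + x)^-1 * a) => //.
rewrite rscale_col2 !mulrA -qrealM divff // mul1r; congr col2.
have -> : qconj y * qreal (r + x)^-1 * a = qreal (r + x)^-1 * (qconj y * a).
  by rewrite -qrealC mulrA.
have -> : qconj y * a = qreal (r + x) * b.
  by rewrite qrealD mulrDl (qrealC r) -eb mulNr subrK.
by rewrite mulrA -qrealM mulVf // mul1r.
Qed.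

(** The second column of [bloch_mx x y + r] spans the same line; it is reached
    from the first one by exchanging the two coordinates. *)
Lemma bloch_lineE_swap (R : fieldType) (r x : R) (y : quat R) :
  x ^+ 2 + qnormsq y = r ^+ 2 -> r - x != 0 ->
  bloch_line r x y = line (col2 y (qreal (r - x))).
Proof.
move=> xy rx0.
have S2 : mx2 0 1 1 0 *m mx2 0 1 1 0 = 1%:M :> 'M[quat R]_2.
  by rewrite mulmx2 !(mul0r, mulr0, mul1r, addr0, add0r) mx2_1.
transitivity (line_act (mx2 0 1 1 0) (bloch_line r (- x) (qconj y))).
  rewrite (@line_act_bloch _ _ (mx2 0 1 1 0) _ _ x _ y) //.
  rewrite /bloch_mx !mulmx2 qconjK !(mul0r, mulr0, mul1r, mulr1, addr0, add0r).
  by congr mx2; congr Quat => /=; rewrite ?opprK ?oppr0.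
rewrite bloch_lineE ?sqrrN ?qnormsq_conj // line_act_line mx2_col2 qconjK.
by rewrite !(mul0r, mul1r, addr0, add0r).
Qed.

(** The angle is an affine function of the Euclidean inner product of the Bloch
    points.  With A = (r + x) (r + x'), expanding |<v, v'>|^2 for the spanning
    vectors and using |y|^2 = (r - x) (r + x) gives
    2 A (r^2 + x x' + Re (y conj y')), while the two squared norms are
    2 r (r + x) and 2 r (r + x'). *)
Lemma angle_bloch (R : rcfType) (r x x' : R) (y y' : quat R)
    (v v' : 'cV[quat R]_2) :
  0 < r -> 0 < r + x -> 0 < r + x' ->
  x ^+ 2 + qnormsq y = r ^+ 2 -> x' ^+ 2 + qnormsq y' = r ^+ 2 ->
  bloch_line r x y v -> bloch_line r x' y' v' -> qnorm v = 1 -> qnorm v' = 1 ->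
  qabs (qdot v v') ^+ 2 = (r ^+ 2 + x * x' + qre (y * qconj y')) / (2 * r ^+ 2).
Proof.
move=> r0 rx rx' xy xy'; rewrite !bloch_lineE ?gt_eqF // => lv lv' nv nv'.
rewrite (angle_rescale lv lv' nv nv') !qnorm_col2 !qnormsq_conj !qnormsq_real.
have Ny : qnormsq y = r ^+ 2 - x ^+ 2 by rewrite -xy addrC addKr.
have Ny' : qnormsq y' = r ^+ 2 - x' ^+ 2 by rewrite -xy' addrC addKr.
rewrite qdot_col2 qconjK.
have -> : qnormsq (qconj (qreal (r + x)) * qreal (r + x') + y * qconj y') =
    ((r + x) * (r + x')) ^+ 2 + (r + x) * (r + x') * 2 * qre (y * qconj y')
    + qnormsq y * qnormsq y'.
  rewrite -(qnormsq_conj y') -qnormsqM; case: (y * qconj y') => a b c d.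
  by rewrite /qnormsq /=; ring.
rewrite Ny Ny'.
have -> : (r + x) ^+ 2 + (r ^+ 2 - x ^+ 2) = 2 * r * (r + x) by ring.
have -> : (r + x') ^+ 2 + (r ^+ 2 - x' ^+ 2) = 2 * r * (r + x') by ring.
by field; rewrite !gt_eqF.
Qed.

(** * The lines of the five-dimensional demicube *)

Notation signs := (bool * bool * bool * bool)%type.

Definition parity (t : signs) : bool :=
  let: (a, b, c, d) := t in a (+) b (+) c (+) d.

(** The bit 1 stands for the sign -1, so the sum of [signs] in the product
    group of the Booleans corresponds to the componentwise product of signs. *)
Definition sign_quat (R : comNzRingType) (t : signs) : quat R :=
  let: (a, b, c, d) := t in
  Quat ((-1) ^+ a) ((-1) ^+ b) ((-1) ^+ c) ((-1) ^+ d).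

(** The real Bloch coordinate is chosen so that the product of all five signs is
    (-1)^p; as t varies these are the vertices of a demicube on the sphere of
    radius sqrt 5. *)
Definition demi_line (R : rcfType) (p : bool) (t : signs) : set 'cV[quat R]_2 :=
  bloch_line (Num.sqrt 5) ((-1) ^+ (p (+) parity t)) (sign_quat R t).

(** The value of (5 + <e, e'>) / 10 for two vertices e, e' of one demicube whose
    componentwise product has the last four signs t; its first sign is then
    the product of these four. *)
Definition sign_angle (R : rcfType) (t : signs) : R :=
  (5 + (-1) ^+ parity t + (let: (a, b, c, d) := t in
     (-1) ^+ a + (-1) ^+ b + (-1) ^+ c + (-1) ^+ d)) / 10.

Lemma sqr_sqrt5 (R : rcfType) : Num.sqrt 5 ^+ 2 = 5 :> R.
Proof. by rewrite sqr_sqrtr. Qed.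

Lemma sqrt5_gt1 (R : rcfType) : 1 < Num.sqrt 5 :> R.
Proof. by rewrite -{1}sqrtr1 ltr_sqrt // ltr1n. Qed.

Lemma sqrt5_sign_gt0 (R : rcfType) (b : bool) : 0 < Num.sqrt 5 + (-1) ^+ b :> R.
Proof. by have := sqrt5_gt1 R; case: b; rewrite ?expr0 ?expr1 => ?; lra. Qed.

Lemma qnormsq_sign (R : comNzRingType) (t : signs) : qnormsq (sign_quat R t) = 4.
Proof. by case: t => [[[a b] c] d]; rewrite /qnormsq /= !sqrr_sign; ring. Qed.

Lemma demi_line_sphere (R : rcfType) (b : bool) (t : signs) :
  ((-1) ^+ b) ^+ 2 + qnormsq (sign_quat R t) = Num.sqrt 5 ^+ 2.
Proof. by rewrite sqr_sqrt5 sqrr_sign qnormsq_sign; ring. Qed.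

(** Angles depend only on t + t', since every coordinate contributes the product
    of two signs; the set of lines is thus homogeneous under sign changes. *)
Lemma demi_line_angle (R : rcfType) (p : bool) (t t' : signs) (v v' : 'cV[quat R]_2) :
  demi_line p t v -> demi_line p t' v' -> qnorm v = 1 -> qnorm v' = 1 ->
  qabs (qdot v v') ^+ 2 = sign_angle R (t + t').
Proof.
move=> tv tv' nv nv'.
rewrite (angle_bloch _ _ _ _ _ tv tv') ?demi_line_sphere ?sqrt5_sign_gt0 //;
  last by rewrite (lt_trans ltr01 (sqrt5_gt1 R)).
rewrite sqr_sqrt5; have -> : 2 * 5 = 10 :> R by ring.
congr (_ / _); rewrite -addrA -[RHS]addrA; congr (_ + _).
case: t t' {tv tv'} => [[[a b] c] d] [[[a' b'] c'] d'] /=.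
rewrite -signr_addb !mulrN !opprK -!signr_addb; congr (_ + _).
by congr (_ ^+ nat_of_bool _); case: p a b c d a' b' c' d' => [] [] [] [] [] [] [] [] [].
Qed.

(** Two vertices of a demicube differ in 0, 2 or 4 places, which leaves the inner
    products 1 and -3 for different vertices. *)
Lemma sign_angle_values (R : rcfType) (t : signs) :
  t != 0 -> sign_angle R t = 1 / 5 \/ sign_angle R t = 3 / 5.
Proof.
case: t => [[[a b] c] d]; rewrite /sign_angle /=.
by case: a b c d => [] [] [] [] // _; rewrite !expr0 !expr1;
  (left; lra) || (right; lra).
Qed.

Lemma sum_signs (V : nmodType) (F : signs -> V) :
  \sum_t F t = \sum_a \sum_b \sum_c \sum_d F (a, b, c, d).
Proof. by rewrite !pair_bigA /=; apply: eq_bigr => -[[[a b] c] d]. Qed.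

(** From a fixed vertex: 1 at angle 1, 10 at angle 3/5, 5 at angle 1/5, and
    1 + 10 (3/5)^3 + 5 (1/5)^3 = 16/5. *)
Lemma sum_sign_angle3 (R : rcfType) : \sum_t sign_angle R t ^+ 3 = 16 / 5.
Proof.
by rewrite sum_signs !big_bool /sign_angle /= !expr0 !expr1; field.
Qed.

Definition demi_vec (R : rcfType) (p : bool) (t : signs) : 'cV[quat R]_2 :=
  normalize (col2 (qreal (Num.sqrt 5 + (-1) ^+ (p (+) parity t)))
                  (qconj (sign_quat R t))).

Lemma demi_vecP (R : rcfType) (p : bool) (t : signs) :
  qnorm (demi_vec R p t) = 1 /\ line (demi_vec R p t) = demi_line p t.
Proof.
have n0 : qnorm (col2 (qreal (Num.sqrt 5 + (-1) ^+ (p (+) parity t)))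
                  (qconj (sign_quat R t))) != 0.
  apply/eqP => n0; have /eqP := qnorm_col2
    (qreal (Num.sqrt 5 + (-1) ^+ (p (+) parity t))) (qconj (sign_quat R t)).
  rewrite n0 expr0n /= qnormsq_real qnormsq_conj qnormsq_sign eq_sym.
  by rewrite gt_eqF // ltr_wpDl ?sqr_ge0.
split; first exact: qnorm_normalize.
by rewrite line_normalize // /demi_line bloch_lineE ?demi_line_sphere
  ?gt_eqF ?sqrt5_sign_gt0.
Qed.

Lemma signs_addr_eq0 (t t' : signs) : (t + t' == 0) = (t == t').
Proof. by rewrite addr_eq0; case: t' => [[[a b] c] d]. Qed.

(** A line that occurs twice would contain one unit vector v with <v, v> = 1,
    whereas different indices force an angle 1/5 or 3/5. *)
Lemma demi_line_inj (R : rcfType) (p : bool) : injective (@demi_line R p).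
Proof.
move=> t t' tt'; have [nv lv] := demi_vecP R p t.
have tv : demi_line p t (demi_vec R p t) by rewrite -lv; exact: line_self.
have t'v : demi_line p t' (demi_vec R p t) by rewrite -tt'.
have := demi_line_angle tv t'v nv nv.
rewrite qabs_sqr qdot_qnorm nv expr1n qnormsq_real expr1n.
have [//|] := eqVneq t t'; rewrite -signs_addr_eq0 => /(sign_angle_values R).
by case=> -> {lv tv t'v tt'} ?; exfalso; lra.
Qed.

Definition demi_lines (R : rcfType) (p : bool) : set (set 'cV[quat R]_2) :=
  range (@demi_line R p).
Arguments demi_lines R p : clear implicits.

Lemma lines_given_by_card (R : rcfType) (d n : nat) (v : 'I_n -> 'cV[quat R]_d)
    (X : set (set 'cV[quat R]_d)) : lines_given_by v X -> (X #= `I_n)%card.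
Proof.
case=> _ v_inj ->; apply: card_eq_trans (card_esym card_II).
by apply: inj_card_eq => a b _ _; exact: v_inj.
Qed.

Lemma demi_lines_given_by (R : rcfType) (p : bool) :
  lines_given_by (fun i : 'I_#|{: signs}| => demi_vec R p (enum_val i))
    (demi_lines R p).
Proof.
split=> [a|a b /=|]; first by have [] := demi_vecP R p (enum_val a).
  have [_ ->] := demi_vecP R p (enum_val a).
  have [_ ->] := demi_vecP R p (enum_val b).
  by move=> /demi_line_inj/enum_val_inj.
apply/seteqP; split=> [_ [t _ <-]|_ [a _ <-]].
  by exists (enum_rank t) => //; rewrite enum_rankK; have [] := demi_vecP R p t.
by exists (enum_val a) => //; have [] := demi_vecP R p (enum_val a).
Qed.

Lemma card_signs : #|{: signs}| = 16%N.
Proof. by rewrite !card_prod card_bool. Qed.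

Lemma demi_lines_card (R : rcfType) (p : bool) : (demi_lines R p #= `I_16)%card.
Proof. by rewrite -card_signs; exact: lines_given_by_card (demi_lines_given_by R p). Qed.

Lemma demi_lines_angle_set (R : rcfType) (p : bool) :
  angle_set (demi_lines R p) = [set 1 / 5; 3 / 5].
Proof.
apply/seteqP; split=> [r|r rE].
  move=> [v [w [[nv nw] [t _ tv] [t' _ t'w] vw ->]]].
  have dv : demi_line p t v by rewrite tv; exact: line_self.
  have dw : demi_line p t' w by rewrite t'w; exact: line_self.
  rewrite (demi_line_angle dv dw nv nw); apply: sign_angle_values.
  by rewrite signs_addr_eq0; apply/eqP => tt'; apply: vw; rewrite -tv -t'w tt'.
have [t t0 ->] : exists2 t : signs, t != 0 & r = sign_angle R t.
  case: rE => ->; rewrite /sign_angle.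
    by exists (true, true, true, true) => //=; rewrite !expr0 !expr1; lra.
  by exists (true, false, false, true) => //=; rewrite !expr0 !expr1; lra.
have [n1 l1] := demi_vecP R p t; have [n0 l0] := demi_vecP R p 0.
exists (demi_vec R p t), (demi_vec R p 0); split.
- by split.
- by rewrite l1; exists t.
- by rewrite l0; exists 0.
- by rewrite l1 l0 => /demi_line_inj/eqP; apply/negP.
rewrite (@demi_line_angle _ p t 0) ?addr0 //; first by rewrite -l1; exact: line_self.
by rewrite -l0; exact: line_self.
Qed.

Lemma sum_enum_signs (V : nmodType) (F : signs -> V) :
  \sum_(i < #|{: signs}|) F (enum_val i) = \sum_t F t.
Proof. by rewrite -(@big_enum_val _ _ +%R _ predT F). Qed.

(** By homogeneity every row of the double sum equals 16/5, so the total is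
    16 * 16/5 = 16^2 / 5, and the design constant is (2/4)(3/5)(4/6) = 1/5. *)
Lemma demi_lines_design (R : rcfType) (p : bool) :
  spherical_design 3 (demi_lines R p).
Proof.
exists #|{: signs}|, (fun i => demi_vec R p (enum_val i)).
split; first exact: demi_lines_given_by.
have nE t : qnorm (demi_vec R p t) = 1 by have [] := demi_vecP R p t.
have dE t : demi_line p t (demi_vec R p t).
  by have [_ <-] := demi_vecP R p t; exact: line_self.
rewrite (sum_enum_signs (fun t => \sum_(b < #|{: signs}|)
  qabs (qdot (demi_vec R p t) (demi_vec R p (enum_val b))) ^+ (2 * 3))).
rewrite (eq_bigr (fun=> 16 / 5)) => [|t _]; last first.
  rewrite (sum_enum_signs (fun t' =>
    qabs (qdot (demi_vec R p t) (demi_vec R p t')) ^+ (2 * 3))).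
  (* Translating the index by t makes the row independent of t. *)
  rewrite -sum_sign_angle3 [RHS](reindex_inj (addrI t)); apply: eq_bigr => t' _.
  by rewrite exprM (demi_line_angle (dE t) (dE t')).
rewrite [in RHS](eq_bigr (fun=> 1)) => [|l _]; last by rewrite nE expr1n.
rewrite !sumr_const card_ord card_signs.
by rewrite /design_const !big_nat_recl // big_geq //=; field.
Qed.

Lemma demi_lines_special_bound (R : rcfType) (p : bool) :
  meets_special_bound (demi_lines R p) (1 / 5) (3 / 5).
Proof.
split; first by split; apply/eqP => ?; lra.
  exact: demi_lines_angle_set.
exists 16%N; split; first exact: demi_lines_card.
by rewrite /special_bound; field.
Qed.

(** * The action of the generators *)

(** Left multiplication by i on the quaternion of signs. *)
Definition sign_i (t : signs) : signs :=
  let: (a, b, c, d) := t in (~~ b, a, ~~ d, c).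

(** Left multiplication by j on the quaternion of signs. *)
Definition sign_j (t : signs) : signs :=
  let: (a, b, c, d) := t in (~~ c, d, a, ~~ b).

(** Conjugation by [refl_mx] below: with Bloch coordinates (x, a, b, c, d) it
    exchanges x with c and b with d, and then negates the new c and d. *)
Definition sign_refl (p : bool) (t : signs) : signs :=
  let: (a, b, c, d) := t in (a, d, ~~ (p (+) parity t), ~~ b).

Lemma permutes_demi_lines (R : rcfType) (p : bool) (g h : 'M[quat R]_2)
    (f : signs -> signs) :
  g *m h = 1%:M -> h *m g = 1%:M -> injective f ->
  (forall t, line_act g (demi_line p t) = demi_line p (f t)) ->
  permutes_lines (demi_lines R p) g.
Proof.
move=> gh hg /injF_bij[f' _ f'K] gE; split; first by exists h.
apply/seteqP; split=> [_ [_ [t _ <-] <-]|_ [t _ <-]]; first by rewrite gE; exists (f t).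
by exists (demi_line p (f' t)); [exists (f' t)|rewrite gE f'K].
Qed.

Lemma gen_i_inv (R : comNzRingType) :
  mx2 qi 0 0 1 *m mx2 (- qi) 0 0 1 = 1%:M :> 'M[quat R]_2 /\
  mx2 (- qi) 0 0 1 *m mx2 qi 0 0 1 = 1%:M :> 'M[quat R]_2.
Proof. by split; rewrite mulmx2 -mx2_1; congr mx2; congr Quat => /=; ring. Qed.

Lemma gen_j_inv (R : comNzRingType) :
  mx2 qj 0 0 1 *m mx2 (- qj) 0 0 1 = 1%:M :> 'M[quat R]_2 /\
  mx2 (- qj) 0 0 1 *m mx2 qj 0 0 1 = 1%:M :> 'M[quat R]_2.
Proof. by split; rewrite mulmx2 -mx2_1; congr mx2; congr Quat => /=; ring. Qed.

(** The quaternionic reflection that fixes (1, -1) and multiplies (1, 1) by j. *)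
Definition refl_mx (R : rcfType) : 'M[quat R]_2 :=
  qreal 2^-1 *: mx2 (1 + qj) (-1 + qj) (-1 + qj) (1 + qj).

Definition refl_mxV (R : rcfType) : 'M[quat R]_2 :=
  qreal 2^-1 *: mx2 (1 - qj) (-1 - qj) (-1 - qj) (1 - qj).

Lemma refl_mx_inv (R : rcfType) : refl_mx R *m refl_mxV R = 1%:M /\ refl_mxV R *m refl_mx R = 1%:M.
Proof.
by split; rewrite /refl_mx /refl_mxV !scale_mx2 mulmx2 -mx2_1; congr mx2;
  congr Quat => /=; field.
Qed.

Lemma line_act_i (R : rcfType) p t :
  line_act (mx2 qi 0 0 1) (demi_line p t) = demi_line p (sign_i t) :> set 'cV[quat R]_2.
Proof.
have [gh hg] := gen_i_inv R; case: t => [[[a b] c] d].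
rewrite /demi_line; have -> : parity (sign_i (a, b, c, d)) = parity (a, b, c, d).
  by case: a b c d => [] [] [] [].
apply: line_act_bloch gh hg _.
by rewrite /bloch_mx !mulmx2; congr mx2; congr Quat => /=; rewrite ?signrN; ring.
Qed.

Lemma line_act_j (R : rcfType) p t :
  line_act (mx2 qj 0 0 1) (demi_line p t) = demi_line p (sign_j t) :> set 'cV[quat R]_2.
Proof.
have [gh hg] := gen_j_inv R; case: t => [[[a b] c] d].
rewrite /demi_line; have -> : parity (sign_j (a, b, c, d)) = parity (a, b, c, d).
  by case: a b c d => [] [] [] [].
apply: line_act_bloch gh hg _.
by rewrite /bloch_mx !mulmx2; congr mx2; congr Quat => /=; rewrite ?signrN; ring.
Qed.

Lemma line_act_refl (R : rcfType) p t :
  line_act (refl_mx R) (demi_line p t) = demi_line p (sign_refl p t).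
Proof.
have [gh hg] := refl_mx_inv R; case: t => [[[a b] c] d].
have -> : demi_line p (sign_refl p (a, b, c, d)) = bloch_line (Num.sqrt 5)
    ((-1) ^+ c) (sign_quat R (sign_refl p (a, b, c, d))).
  by congr (bloch_line _ (_ ^+ nat_of_bool _) _); case: p a b c d => [] [] [] [] [].
apply: line_act_bloch gh hg _.
rewrite /refl_mx scale_mx2 /bloch_mx !mulmx2 /sign_quat /sign_refl !signrN.
by congr mx2; congr Quat => /=; field.
Qed.

(** * Transitivity and orbits *)

Definition sign_seq : seq signs :=
  [seq (t, d) | t <- [seq (t, c) | t <- [seq (a, b) | a <- [:: true; false],
     b <- [:: true; false]], c <- [:: true; false]], d <- [:: true; false]].

Lemma mem_sign_seq (t : signs) : t \in sign_seq.
Proof. by case: t => [[[[] []] []] []]. Qed.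

Definition orbit_step (p : bool) (s : seq signs) : seq signs :=
  undup (s ++ map sign_i s ++ map (sign_refl p) s).

(** The generators i and [refl_mx] alone connect all 16 vertices.  The reachable
    set is computed as a breadth-first search; five rounds are enough from
    every starting vertex. *)
Lemma sign_transitive (p : bool) (t t' : signs) :
  t' \in iter 5 (orbit_step p) [:: t].
Proof.
have /allP/(_ t (mem_sign_seq t))/allP/(_ t' (mem_sign_seq t'))// :
  all (fun t => all (fun t' => t' \in iter 5 (orbit_step p) [:: t]) sign_seq) sign_seq.
by case: p; vm_compute.
Qed.

Lemma sign_i_inj : injective sign_i.
Proof. by case=> [[[[] []] []] []] [[[[] []] []] []]. Qed.

Lemma sign_j_inj : injective sign_j.
Proof. by case=> [[[[] []] []] []] [[[[] []] []] []]. Qed.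

Lemma sign_refl_inj (p : bool) : injective (sign_refl p).
Proof. by case: p; case=> [[[[] []] []] []] [[[[] []] []] []]. Qed.

(** One statement covers both groups: i and the reflection are needed for
    transitivity, and j may be added because it preserves the demicube too. *)
Lemma orbit_demi_line (R : rcfType) (p : bool) (t : signs) (S : set 'M[quat R]_2) :
  S (mx2 qi 0 0 1) -> S (refl_mx R) ->
  S `<=` [set mx2 qi 0 0 1; mx2 qj 0 0 1; refl_mx R] ->
  line_orbit (generated_group S) (demi_line p t) = demi_lines R p.
Proof.
move=> Si SB Sgen; apply/seteqP; split.
  apply: orbit_generated_sub; last by exists t.
  move=> g /Sgen [[->|->]|->].
  - have [gh hg] := gen_i_inv R.
    exact: permutes_demi_lines gh hg sign_i_inj (line_act_i R p).
  - have [gh hg] := gen_j_inv R.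
    exact: permutes_demi_lines gh hg sign_j_inj (line_act_j R p).
  have [gh hg] := refl_mx_inv R.
  exact: permutes_demi_lines gh hg (@sign_refl_inj p) (line_act_refl R p).
move=> _ [t' _ <-]; have := sign_transitive p t t'.
elim: 5%N t' => [|n IHn] t'; first by rewrite inE => /eqP ->; exact: orbit_generated1.
rewrite iterS mem_undup !mem_cat => /or3P[/IHn//|/mapP[s /IHn sO ->]|/mapP[s /IHn sO ->]].
  by rewrite -line_act_i; exact: orbit_generated_act.
by rewrite -line_act_refl; exact: orbit_generated_act.
Qed.

(** * The lines spanned by multiples of a sign quaternion *)

Definition q8 (R : comNzRingType) (n : bool * bool * bool) : quat R :=
  let: (s, m, m') := n in
  (-1) ^+ s * (if m then if m' then qk else qj else if m' then qi else 1).

Lemma Q8E (R : comNzRingType) : Q8 R = range (@q8 R).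
Proof.
apply/seteqP; split=> [q|_ [[[[] []] []] _ <-]]; last first.
  1-8: by rewrite /= ?expr0 ?expr1 ?mul1r ?mulN1r /Q8 /=; tauto.
move=> [[[[[[[|]|]|]|]|]|]|] ->.
- by exists (false, false, false); rewrite // /= ?expr0 ?expr1 ?mul1r ?mulN1r.
- by exists (true, false, false); rewrite // /= ?expr0 ?expr1 ?mul1r ?mulN1r.
- by exists (false, false, true); rewrite // /= ?expr0 ?expr1 ?mul1r ?mulN1r.
- by exists (true, false, true); rewrite // /= ?expr0 ?expr1 ?mul1r ?mulN1r.
- by exists (false, true, false); rewrite // /= ?expr0 ?expr1 ?mul1r ?mulN1r.
- by exists (true, true, false); rewrite // /= ?expr0 ?expr1 ?mul1r ?mulN1r.
- by exists (false, true, true); rewrite // /= ?expr0 ?expr1 ?mul1r ?mulN1r.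
- by exists (true, true, true); rewrite // /= ?expr0 ?expr1 ?mul1r ?mulN1r.
Qed.

(** The sign pattern of [q8 n] times a quaternion with coordinates
    ((-1)^(~~ p), 1, 1, 1). *)
Definition q8_signs (p : bool) (n : bool * bool * bool) : signs :=
  let: (s, m, m') := n in
  if m then if m' then (~~ s, ~~ s, s, ~~ p (+) s) else (~~ s, s, ~~ p (+) s, ~~ s)
  else if m' then (~~ s, ~~ p (+) s, ~~ s, s) else (~~ p (+) s, s, s, s).

(** This is 1 + i + j + k for p = true and -1 + i + j + k for p = false. *)
Definition sign_unit (R : comNzRingType) (p : bool) : quat R :=
  Quat ((-1) ^+ (~~ p)) 1 1 1.

Lemma q8_sign_unit (R : comNzRingType) p n :
  q8 R n * sign_unit R p = sign_quat R (q8_signs p n).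
Proof.
by case: p n => [] [[[] []] []]; rewrite /q8 /= ?expr0 ?expr1 ?mul1r ?mulN1r;
  congr Quat => /=; ring.
Qed.

(** Left multiplication by an element of the quaternion group keeps the parity,
    and the eight multiples of a sign quaternion exhaust the eight sign
    quaternions of its parity. *)
Lemma q8_signsP p t : parity t = ~~ p <-> exists n, q8_signs p n = t.
Proof.
split=> [|[n <-]]; last by case: p n => [] [[[] []] []].
pose s := [seq (n, m') | n <- [seq (s, m) | s <- [:: true; false], m <- [:: true; false]],
   m' <- [:: true; false]].
suff tP : (parity t == ~~ p) ==> (t \in map (q8_signs p) s).
  by move=> /eqP/(implyP tP)/mapP[n _ ->]; exists n.
by case: p t => [] [[[[] []] []] []].
Qed.

(** The vectors (1 + sqrt 5, q u) span the lines with real Bloch coordinate 1 and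
    the vectors (q u, 1 + sqrt 5) those with real Bloch coordinate -1.  In the
    first case the Bloch quaternion is the conjugate of q u; conjugation negates
    three signs, and this change of parity is compensated by the real
    coordinate, so both halves lie in one demicube. *)
Lemma Q8_linesE (R : rcfType) (p : bool) : Q8_lines (sign_unit R p) = demi_lines R p.
Proof.
have posE t : parity t = p -> demi_line p t =
    line (col2 (qreal (1 + Num.sqrt 5)) (qconj (sign_quat R t))).
  move=> tp; rewrite /demi_line tp addbb bloch_lineE ?demi_line_sphere //.
    by rewrite addrC.
  by rewrite gt_eqF ?sqrt5_sign_gt0.
have negE t : parity t = ~~ p -> demi_line p t =
    line (col2 (sign_quat R t) (qreal (1 + Num.sqrt 5))).
  move=> tp; rewrite /demi_line tp addbN addbb bloch_lineE_swap ?demi_line_sphere //.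
    by rewrite opprK addrC.
  by rewrite opprK gt_eqF ?(sqrt5_sign_gt0 R false).
pose flip (t : signs) : signs := let: (a, b, c, d) := t in (a, ~~ b, ~~ c, ~~ d).
have flipK : involutive flip by case=> [[[a b] c] d]; rewrite /flip !negbK.
have flip_par t : parity (flip t) = ~~ parity t by case: t => [[[[] []] []] []].
have flip_conj t : qconj (sign_quat R t) = sign_quat R (flip t).
  by case: t => [[[a b] c] d]; rewrite /qconj /= !signrN.
rewrite /Q8_lines Q8E; apply/seteqP; split=> [L [|]|_ [t _ <-]].
- case=> _ [n _ <-] <-; exists (flip (q8_signs p n)) => //.
  rewrite posE ?flip_conj ?flipK ?q8_sign_unit //.
  by rewrite flip_par (q8_signsP p _).2 ?negbK //; exists n.
- case=> _ [n _ <-] <-; exists (q8_signs p n) => //.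
  by rewrite negE ?q8_sign_unit //; apply/q8_signsP; exists n.
have [tp|tp] := eqVneq (parity t) p.
  left; have /q8_signsP[n nE] : parity (flip t) = ~~ p by rewrite flip_par tp.
  by exists (q8 R n); [exists n|rewrite posE // q8_sign_unit nE flip_conj].
right; have tp' : parity t = ~~ p by move: tp; case: (parity t); case: (p).
have /q8_signsP[n nE] := tp'.
by exists (q8 R n); [exists n|rewrite negE // q8_sign_unit nE].
Qed.

Theorem mainTheorem1 (R : realType) :
  let w : 'cV[quat R]_2 :=
    col2 (qreal (1 + Num.sqrt 5)) (1 + qi + qj + qk) in
  let wperp : 'cV[quat R]_2 :=
    col2 (-1 + qi + qj + qk) (qreal (1 + Num.sqrt 5)) in
  let X : set (set 'cV[quat R]_2) := Q8_lines (1 + qi + qj + qk) in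
  let Xperp : set (set 'cV[quat R]_2) := Q8_lines (-1 + qi + qj + qk) in
  [/\ line_orbit (P1 R) (line w) = X,
      line_orbit (P2 R) (line w) = X,
      line_orbit (P1 R) (line wperp) = Xperp
    & line_orbit (P2 R) (line wperp) = Xperp] /\
  (forall Y : set (set 'cV[quat R]_2), Y = X \/ Y = Xperp ->
    [/\ (Y #= `I_16)%card,
        angle_set Y = [set 1 / 5; 3 / 5],
        spherical_design 3 Y
      & meets_special_bound Y (1 / 5) (3 / 5)]).
Proof.
move=> w wperp X Xperp.
have uE : 1 + qi + qj + qk = sign_unit R true by congr Quat => /=; ring.
have uperpE : -1 + qi + qj + qk = sign_unit R false by congr Quat => /=; ring.
have XE : X = demi_lines R true by rewrite /X uE; exact: Q8_linesE.
have XperpE : Xperp = demi_lines R false by rewrite /Xperp uperpE; exact: Q8_linesE.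
have Q1 : Q8 R 1 by rewrite /Q8 /=; tauto.
have [t _ tw] : demi_lines R true (line w).
  by rewrite -XE; left; exists 1 => //; rewrite mul1r.
have [t' _ tw'] : demi_lines R false (line wperp).
  by rewrite -XperpE; right; exists 1 => //; rewrite mul1r.
split; last first.
  have demiP p : [/\ (demi_lines R p #= `I_16)%card,
      angle_set (demi_lines R p) = [set 1 / 5; 3 / 5],
      spherical_design 3 (demi_lines R p)
    & meets_special_bound (demi_lines R p) (1 / 5) (3 / 5)].
    split; [exact: demi_lines_card | exact: demi_lines_angle_set
      | exact: demi_lines_design | exact: demi_lines_special_bound].
  by move=> Y [->|->]; rewrite ?XE ?XperpE.
have P1E p t0 : line_orbit (P1 R) (demi_line p t0) = demi_lines R p.
  apply: orbit_demi_line; [by left | by right |].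
  by move=> g [->|->]; [left; left | right].
have P2E p t0 : line_orbit (P2 R) (demi_line p t0) = demi_lines R p.
  by apply: orbit_demi_line; [left; left | right |].
rewrite XE XperpE -tw -tw'.
by split; [exact: P1E | exact: P2E | exact: P1E | exact: P2E].
Qed.
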